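(* Let $\mathcal{A}$ be a finite nonempty set of arms and let $\epsilon \in (0,1]$. Let $\mathbf{s}$ be any function that assigns to each dataset $\mathcal{D}$ (the data on which the arm scores at round $t$ depend) a score vector $\mathbf{s}(\mathcal{D}) = (s_a(\mathcal{D}))_{a \in \mathcal{A}} \in \mathbb{R}^{\mathcal{A}}$. Let $\mathcal{M}$ be the randomized mechanism that, on input $\mathcal{D}$, outputs only the single action $a_t = \pi(\mathbf{s}(\mathcal{D})) \in \mathcal{A}$ selected at round $t$ by the $\epsilon$-greedy policy $\pi$ applied to the scores $\mathbf{s}(\mathcal{D})$. Then $\mathcal{M}$ is $\log(|\mathcal{A}|/\epsilon)$-differentially private; that is, for all datasets $\mathcal{D}, \mathcal{D}'$ that differ by a single example and all $\mathcal{S} \subseteq \mathcal{A}$, $$P(\mathcal{M}(\mathcal{D}) \in \mathcal{S}) \le \frac{|\mathcal{A}|}{\epsilon}\, P(\mathcal{M}(\mathcal{D}') \in \mathcal{S}).$$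
   Context: **$\epsilon$-greedy policy.** Given a score vector $\mathbf{s} = (s_a)_{a\in\mathcal{A}} \in \mathbb{R}^{\mathcal{A}}$, the $\epsilon$-greedy policy $\pi$ independently draws $y \sim \mathrm{Bernoulli}(\epsilon)$. If $y = 1$, it selects an arm uniformly at random from $\mathcal{A}$. If $y = 0$, it selects $\operatorname{argmax}_{a \in \mathcal{A}} s_a$, where ties (if there are several maximizers) are broken uniformly at random among the maximizers. In particular, if the maximizer is unique, it is selected with probability $(1-\epsilon) + \epsilon/|\mathcal{A}|$ and every other arm is selected with probability $\epsilon/|\mathcal{A}|$. **Differential privacy.** A randomized mechanism $\mathcal{M}$ is $\eta$-differentially private if for all datasets $\mathcal{D}$ and $\mathcal{D}'$ that differ by a single example and for all output sets $\mathcal{S} \subseteq \mathrm{Range}(\mathcal{M})$, $$P(\mathcal{M}(\mathcal{D}) \in \mathcal{S}) \le e^{\eta}\, P(\mathcal{M}(\mathcal{D}') \in \mathcal{S}).$$ Datasets are finite collections of examples, and the scores at round $t$ are a deterministic function of the dataset; the only randomness in $\mathcal{M}$ is that of the $\epsilon$-greedy selection at round $t$. The logarithm is the natural logarithm. *)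

(* Defs.v *)
From HB Require Import structures.
From mathcomp Require Export all_boot all_order all_algebra.
From mathcomp Require Export all_classical all_reals all_analysis.

Set Implicit Arguments.
Unset Strict Implicit.
Unset Printing Implicit Defensive.

Import Order.TTheory GRing.Theory Num.Theory.
Import numFieldNormedType.Exports.
Local Open Scope classical_set_scope.
Local Open Scope ring_scope.

(* A nonempty finite type with the discrete sigma-algebra: every
   [S : set (discrete A0)] is measurable. Measurable types of the library are
   pointed, whence the proof of nonemptiness as a parameter. *)
Definition discrete (A : finType) (A0 : (0 < #|A|)%N) : Type := A.

Section discrete.
Context (A : finType) (A0 : (0 < #|A|)%N).

HB.instance Definition _ := Finite.on (discrete A0).
HB.instance Definition _ :=
  isPointed.Build (discrete A0) (enum_val (Ordinal A0)).
HB.instance Definition _ :=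
  @isMeasurable.Build default_measure_display (discrete A0)
    discrete_measurable discrete_measurable0
    (@discrete_measurableC _) (@discrete_measurableU _).

End discrete.

Section uniform_on.
Context (R : realType) (A : finType) (A0 : (0 < #|A|)%N)
  (B : {set A}) (B0 : (0 < #|B|)%N).
Local Open Scope ereal_scope.

Definition uniform_on (_ : (0 < #|B|)%N) : set (discrete A0) -> \bar R := fun S =>
  \sum_(a in B) (#|B|%:R^-1)%:E * \d_(a : discrete A0) S.

Local Notation U := (uniform_on B0).

Let c_ge0 : (0 <= (#|B|%:R^-1 : R)%:E). Proof. by rewrite lee_fin. Qed.

Let uniform_on0 : U set0 = 0.
Proof. by rewrite /uniform_on big1// => a _; rewrite measure0 mule0. Qed.

Let uniform_on_ge0 S : 0 <= U S.
Proof. by apply: sume_ge0 => a _; exact: mule_ge0. Qed.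

Let uniform_on_additive : semi_sigma_additive U.
Proof.
move=> F mF tF mUF; apply: cvg_toP.
  by apply: is_cvg_nneseries => n _ _; exact: uniform_on_ge0.
rewrite /uniform_on nneseries_sum; last first.
  by move=> a n _; apply: mule_ge0; [exact: c_ge0|exact: measure_ge0].
apply: eq_bigr => a _; rewrite nneseriesZl; last first.
  by move=> n _; exact: measure_ge0.
congr (_ * _).
by apply/cvg_lim => //; exact: (@measure_semi_sigma_additive _ _ _ \d_(a : discrete A0)).
Qed.

HB.instance Definition _ := isMeasure.Build _ _ _ U
  uniform_on0 uniform_on_ge0 uniform_on_additive.

Let uniform_on_setT : U setT = 1.
Proof.
rewrite /uniform_on; under eq_bigr do rewrite diracT mule1.
rewrite sumEFin sumr_const -[(_ *+ _)%R]mulr_natl divff//.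
by rewrite pnatr_eq0 -lt0n.
Qed.

HB.instance Definition _ := @Measure_isProbability.Build _ _ R U uniform_on_setT.

End uniform_on.
Arguments uniform_on R {A} A0 {B} _ _.

Section argmax.
Context (R : realType) (A : finType).

Definition argmax (s : A -> R) : {set A} := finset (fun a => [forall b, s b <= s a]).

Lemma argmax_gt0 (s : A -> R) : (0 < #|A|)%N -> (0 < #|argmax s|)%N.
Proof.
move=> /card_gt0P[a0 _]; apply/card_gt0P.
case: (@arg_maxP _ _ _ a0 xpredT s isT) => a _ amax.
by exists a; rewrite inE; apply/forallP => b; exact: amax.
Qed.

End argmax.

Lemma setT_gt0 (A : finType) : (0 < #|A|)%N -> (0 < #|[set: A]%SET|)%N.
Proof. by rewrite cardsT. Qed.

Section eps_greedy.
Context (R : realType) (A : finType) (A0 : (0 < #|A|)%N).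

(* Law of the selected arm given the Bernoulli draw [y]. *)
Definition greedy_step (s : A -> R) (y : bool) : probability (discrete A0) R :=
  if y return probability (discrete A0) R then uniform_on R A0 (setT_gt0 A0)
  else uniform_on R A0 (argmax_gt0 s A0).

Local Open Scope ereal_scope.

(* [bernoulli_prob eps] gives mass [eps] to [true] when [0 <= eps <= 1]; outside
   this range the library sets it to the Dirac measure at [false]. *)
Definition eps_greedy (eps : R) (s : A -> R) : set (discrete A0) -> \bar R :=
  fun S => \int[bernoulli_prob eps]_y greedy_step s y S.

Context (eps : R) (s : A -> R).
Local Notation G := (eps_greedy eps s).

Let eps_greedy0 : G set0 = 0.
Proof. by apply: integral0_eq => y _; rewrite measure0. Qed.

Let eps_greedy_ge0 S : 0 <= G S.
Proof. by apply: integral_ge0 => y _; exact: measure_ge0. Qed.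

Let eps_greedy_additive : semi_sigma_additive G.
Proof.
move=> F mF tF mUF; apply: cvg_toP.
  by apply: is_cvg_nneseries => n _ _; exact: eps_greedy_ge0.
rewrite /eps_greedy -integral_nneseries//.
apply: eq_integral => y _; apply/cvg_lim => //.
exact: (@measure_semi_sigma_additive _ _ _ (greedy_step s y)).
Qed.

HB.instance Definition _ := isMeasure.Build _ _ _ G
  eps_greedy0 eps_greedy_ge0 eps_greedy_additive.

Let eps_greedy_setT : G setT = 1.
Proof.
rewrite /eps_greedy (eq_integral (cst 1)); last first.
  by move=> y _; rewrite probability_setT.
rewrite integral_cst// mul1e; exact: (probability_setT (bernoulli_prob eps)).
Qed.

HB.instance Definition _ := @Measure_isProbability.Build _ _ R G eps_greedy_setT.

End eps_greedy.
Arguments eps_greedy {R A} A0 eps s _.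

(* Finite collections of examples, kept as lists: the order and multiplicity of
   the examples are available to whatever is computed from the dataset. *)
Definition dataset (X : Type) : Type := seq X.

(* Covers both usual conventions, adding or removing one example and replacing
   one example by another. *)
Inductive differ_by_one (X : Type) : dataset X -> dataset X -> Prop :=
| DifferAdd (l1 l2 : seq X) (x : X) :
    differ_by_one (l1 ++ l2) (l1 ++ x :: l2)
| DifferRemove (l1 l2 : seq X) (x : X) :
    differ_by_one (l1 ++ x :: l2) (l1 ++ l2)
| DifferReplace (l1 l2 : seq X) (x x' : X) : x <> x' ->
    differ_by_one (l1 ++ x :: l2) (l1 ++ x' :: l2).

(* A mechanism is given by the law of its output on each dataset. *)
Definition differentially_private (R : realType) (X : Type)
    (d : measure_display) (T : measurableType d)
    (eta : R) (M : dataset X -> probability T R) : Prop :=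
  forall D D' : dataset X, differ_by_one D D' ->
  forall S : set T, measurable S ->
    (M D S <= (expR eta)%:E * M D' S)%E.

Definition eps_greedy_mechanism (R : realType) (X : Type) (A : finType)
    (A0 : (0 < #|A|)%N) (eps : R) (s : dataset X -> A -> R) :
    dataset X -> probability (discrete A0) R :=
  fun D => eps_greedy A0 eps (s D).
Arguments eps_greedy_mechanism {R X A} A0 eps s _.

(* Main.v *)
Require Import Defs.
Import Order.TTheory GRing.Theory Num.Theory.
Local Open Scope classical_set_scope.
Local Open Scope ring_scope.

(** Whatever the scores, exploration alone selects each arm with probability at least [eps / #|A|]
    ([eps_greedy_ge]). A nonempty [S] therefore has at least this mass under [D'], so multiplying
    that mass by [#|A| / eps] gives at least 1, which bounds any probability under [D]. *)

(* The uniform exploration branch alone gives every arm this mass. *)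
Lemma eps_greedy_ge (R : realType) (A : finType) (A0 : (0 < #|A|)%N)
    (eps : R) (eps01 : 0 <= eps <= 1) (s : A -> R)
    (S : set (discrete A0)) (a : discrete A0) :
  S a -> ((eps / #|A|%:R)%:E <= eps_greedy A0 eps s S)%E.
Proof.
move=> Sa; rewrite /eps_greedy integral_bernoulli_prob//=.
have U_ge : ((#|A|%:R^-1)%:E <= uniform_on R A0 (setT_gt0 A0) S)%E.
  (* Only the Dirac mass at [a] is kept; the other terms are nonnegative. *)
  rewrite /uniform_on (bigD1 (a : A))/= ?inE// cardsT diracE mem_set// mule1.
  by rewrite leeDl// sume_ge0// => b _; rewrite mule_ge0// lee_fin invr_ge0.
case/andP: eps01 => eps0 eps1.
(* The greedy branch has weight [1 - eps >= 0] and is dropped. *)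
rewrite EFinM (le_trans (lee_wpmul2l _ U_ge)) ?lee_fin//.
by rewrite leeDl// mule_ge0// lee_fin subr_ge0.
Qed.

Theorem theorem1 (R : realType) (X : Type) (A : finType) (A0 : (0 < #|A|)%N)
    (eps : R) (eps01 : 0 < eps <= 1) (s : dataset X -> A -> R) :
  differentially_private (ln (#|A|%:R / eps)) (eps_greedy_mechanism A0 eps s)
  /\ forall D D' : dataset X, differ_by_one D D' ->
     forall S : set (discrete A0),
       (eps_greedy_mechanism A0 eps s D S
         <= (#|A|%:R / eps)%:E * eps_greedy_mechanism A0 eps s D' S)%E.
Proof.
have /andP[eps0 eps1] := eps01.
have cA0 : 0 < #|A|%:R :> R by rewrite ltr0n.
have bound (D D' : dataset X) (S : set (discrete A0)) :
    (eps_greedy_mechanism A0 eps s D S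
      <= (#|A|%:R / eps)%:E * eps_greedy_mechanism A0 eps s D' S)%E.
  (* The lower bound needs an arm in [S]; for empty [S] both sides vanish. *)
  have [->|/set0P[a Sa]] := eqVneq S set0; first by rewrite !measure0 mule0.
  rewrite (le_trans (probability_le1 _ _))//.
  have eps01' : 0 <= eps <= 1 by rewrite ltW.
  have ge := eps_greedy_ge _ _ A0 _ eps01' (s D') _ _ Sa.
  (* The two factors [#|A| / eps] and [eps / #|A|] cancel to 1. *)
  apply: le_trans (lee_wpmul2l _ ge); last by rewrite lee_fin divr_ge0// ltW.
  by rewrite -EFinM lee_fin mulrA divfK ?gt_eqF// divff ?gt_eqF.
split=> [D D' _ S _|D D' _ S]; last exact: bound.
by rewrite lnK ?posrE ?divr_gt0.
Qed.
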